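(* Let $y,z$ be distinct positive integers and $j\ge0$ an integer. (a) On $W_0=\mathbb{N}$, the extraction sieve $\mathcal{C}_{j,y,z}$ produces the $(j,1,y,z)$-hiccup sequence: $s_1=1$ and, for $n\ge1$, $$s_{n+1}-s_n=\begin{cases}y & \text{if } n+1-j\in\{s_1,\ldots,s_n\},\\ z & \text{otherwise.}\end{cases}$$ (b) On $W_0=a\mathbb{N}+b$ with integers $a\ge1$, $0\le b<a$, the sequence $(s_n)$ produced by $\mathcal{C}_{j,y,z}$ is the $(j,\,a+b,\,ay,\,az)$-hiccup sequence. That is, $s_1=a+b$ and $s_{n+1}-s_n\in\{ay,az\}$, with the large gap $a\max(y,z)$ occurring when the membership condition of step (iii) of the sieve is met.
   Context: $\mathbb{N}=\{1,2,3,\ldots\}$ and $a\mathbb{N}+b=\{an+b:n\ge1\}$. Extraction sieve $\mathcal{C}_{j,y,z}$: set $m=\min(y,z)-1$ and $d=|y-z|$. Let $W_0$ be an infinite strictly increasing sequence of positive integers. The sieve builds $(s_n)_{n\ge1}$ as follows. At step $n\ge1$, starting from the current working sequence $W_{n-1}$: (i) set $s_n:=\min W_{n-1}$ and remove it; (ii) delete the next $m$ smallest remaining elements (always); (iii) let $t=n+1-j$; if either $y>z$ and $t\in\{s_1,\ldots,s_n\}$, or $y<z$ and $t\notin\{s_1,\ldots,s_n\}$, delete the $d$ next smallest remaining elements. The resulting sequence is $W_n$. Hiccup sequences: let $y,z$ be distinct positive integers, $x\ge0$ and $j\ge0$ integers. An increasing sequence $(x_n)_{n\ge1}$ of integers with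 $x_1=x$ is a $(j,x,y,z)$-hiccup sequence if for every $n\ge2$, $x_n-x_{n-1}=y$ if $n-j\in\{x_1,\ldots,x_{n-1}\}$ and $x_n-x_{n-1}=z$ otherwise. *)

(* Defs.v *)
From mathcomp Require Import all_boot all_order all_algebra.
From mathcomp Require Import boolp classical_sets.

Set Implicit Arguments.
Unset Strict Implicit.
Unset Printing Implicit Defensive.

Import Order.TTheory GRing.Theory Num.Theory.

Local Open Scope classical_set_scope.
Local Open Scope ring_scope.

(* An infinite strictly increasing sequence of positive integers is represented
   by the infinite set of its terms. *)

(* The least element of W (0 if W is empty, which never happens when the sieve
   starts from an infinite set). *)
Definition set_min (W : set nat) : nat := xget 0%N (W `&` lbound W).

Definition delete_min (W : set nat) : set nat := W `\ set_min W.

Definition delete_smallest (k : nat) (W : set nat) : set nat :=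
  iter k delete_min W.

(* n - j is computed in int, because it may be negative. *)
Definition shift_in (n j : nat) (S : seq int) : bool := (n%:Z - j%:Z) \in S.

(* Condition of step (iii) at step n, where S lists s_1, ..., s_n and
   t = n + 1 - j. *)
Definition extra_deletion (j y z n : nat) (S : seq nat) : bool :=
  let t_in := shift_in n.+1 j [seq v%:Z | v <- S] in
  ((z < y)%N && t_in) || ((y < z)%N && ~~ t_in).

(* (W_(n-1), [:: s_1; ...; s_(n-1)]) |-> (W_n, [:: s_1; ...; s_n]) *)
Definition sieve_step (j y z n : nat) (WS : set nat * seq nat) :
    set nat * seq nat :=
  let m := (minn y z).-1 in
  let d := `|y%:Z - z%:Z|%N in
  let S := rcons WS.2 (set_min WS.1) in
  let W := delete_smallest m (delete_min WS.1) in
  (if extra_deletion j y z n S then delete_smallest d W else W, S).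

Fixpoint sieve_state (j y z : nat) (W0 : set nat) (n : nat) :
    set nat * seq nat :=
  if n is k.+1 then sieve_step j y z n (sieve_state j y z W0 k)
  else (W0, [::]).

(* s_n = min W_(n-1) for n >= 1; the value at n = 0 is junk. *)
Definition sieve (j y z : nat) (W0 : set nat) (n : nat) : nat :=
  set_min (sieve_state j y z W0 n.-1).1.

(* Sequences (x_n)_(n >= 1) are functions on nat whose value at 0 is ignored;
   index_iota 1 n enumerates 1, ..., n - 1. *)
Definition hiccup (j x y z : nat) (u : nat -> int) : Prop :=
  [/\ u 1%N = x%:Z,
      forall n, (1 <= n)%N -> u n < u n.+1 &
      forall n, (2 <= n)%N ->
        u n - u n.-1 =
          if shift_in n j [seq u i | i <- index_iota 1 n] then y%:Z else z%:Z].

Definition positives : set nat := [set n | (1 <= n)%N].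

Definition progression (a b : nat) : set nat :=
  [set (a * n + b)%N | n in positives].

(* Main.v *)
(* On the terms a n + b with n >= k of an arithmetic progression, deleting the
   least element just increments k.  Every step of the sieve therefore leaves
   such a tail, and moves the minimum by a times the number of deleted
   elements: 1 + m = min(y, z), or 1 + m + d = max(y, z) when the condition of
   step (iii) holds.  Since y <> z, this number is y or z according to whether
   t belongs to {s_1, ..., s_n}. *)
Require Import Defs.
From mathcomp Require Import all_boot all_order all_algebra.
From mathcomp Require Import boolp classical_sets.
From mathcomp Require Import zify.

Set Implicit Arguments.
Unset Strict Implicit.
Unset Printing Implicit Defensive.

Import Order.TTheory GRing.Theory Num.Theory.

Local Open Scope classical_set_scope.
Local Open Scope ring_scope.

Definition progression_from (a b k : nat) : set nat :=
  [set (a * n + b)%N | n in [set n | (k <= n)%N]].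

Lemma set_min_eq (W : set nat) (w : nat) :
  W w -> lbound W w -> set_min W = w.
Proof.
move=> Ww lbw; apply: (@xget_unique _ 0%N (W `&` lbound W)) => [//|v [Wv lbv]].
by apply/eqP; rewrite eq_le lbv // lbw.
Qed.

Lemma set_min_progression_from (a b k : nat) :
  set_min (progression_from a b k) = (a * k + b)%N.
Proof.
apply: set_min_eq; first by exists k => /=.
by move=> _ [n /= le_kn <-]; rewrite leEnat leq_add2r leq_mul2l le_kn orbT.
Qed.

(** Since [a] is positive, [n |-> a * n + b] is injective, so removing the value at [k] removes the
    index [k] alone. *)
Lemma delete_min_progression_from (a b k : nat) : (0 < a)%N ->
  delete_min (progression_from a b k) = progression_from a b k.+1.
Proof.
move=> a_gt0; rewrite /delete_min set_min_progression_from.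
apply/seteqP; split=> v /=.
  move=> [[n /= le_kn <-] neq]; exists n => //=.
  by rewrite ltn_neqAle le_kn andbT; apply: contra_notN neq => /eqP ->.
move=> [n /= lt_kn <-]; split; first by exists n => //=; exact: ltnW.
by apply/eqP; rewrite eqn_add2r eqn_pmul2l // gtn_eqF.
Qed.

Lemma delete_smallest_progression_from (a b k m : nat) : (0 < a)%N ->
  delete_smallest m (progression_from a b k) = progression_from a b (m + k).
Proof.
move=> a_gt0; rewrite /delete_smallest; elim: m => //= m ->.
by rewrite delete_min_progression_from.
Qed.

Lemma progression_from1 (a b : nat) :
  progression a b = progression_from a b 1.
Proof. by []. Qed.

(** Makes part (a) the instance [a = 1], [b = 0] of part (b). *)
Lemma positives_progression : positives = progression 1 0.
Proof.
apply/seteqP; split=> n /=; first by exists n; rewrite // mul1n addn0.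
by move=> [m /= m_gt0 <-]; rewrite /positives /= mul1n addn0.
Qed.

(** Step [n.+1] appends the minimum of the current set, which is [sieve j y z W n.+1] by definition.
    Step (iii) can thus be read as a condition on the output sequence, as [hiccup] requires. *)
Lemma sieve_state_seq (j y z : nat) (W : set nat) (n : nat) :
  (sieve_state j y z W n).2 = [seq sieve j y z W i | i <- index_iota 1 n.+1].
Proof.
elim: n => // n IHn.
have -> : index_iota 1 n.+2 = rcons (index_iota 1 n.+1) n.+1.
  by rewrite /index_iota !subSS !subn0 -{1}(addn1 n) iotaD cats1.
by rewrite map_rcons -IHn.
Qed.

Lemma sieve_stateS_progression_from (j y z a b k n : nat) (W : set nat)
    (s := sieve j y z W) :
  (0 < y)%N -> (0 < z)%N -> (0 < a)%N ->
  (sieve_state j y z W n).1 = progression_from a b k ->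
  (sieve_state j y z W n.+1).1 =
  progression_from a b
    ((if extra_deletion j y z n.+1 [seq s i | i <- index_iota 1 n.+2]
      then maxn y z else minn y z) + k).
Proof.
move=> y_gt0 z_gt0 a_gt0 Wn; rewrite -sieve_state_seq /= Wn.
rewrite delete_min_progression_from // !delete_smallest_progression_from //.
(* The count is [1 + m = minn y z], valid because [minn y z] is positive and so [.-1] does not
   truncate; adding [d] gives [maxn y z]. *)
by case: ifP => _; congr progression_from; lia.
Qed.

(** An unspecified [k] suffices, since gaps only involve its increment over one step. *)
Lemma sieve_state_progression (j y z a b n : nat) :
  (0 < y)%N -> (0 < z)%N -> (0 < a)%N ->
  exists k,
    (sieve_state j y z (progression a b) n).1 = progression_from a b k.
Proof.
move=> y_gt0 z_gt0 a_gt0; elim: n => [|n [k Wn]]; first by exists 1%N.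
by rewrite (sieve_stateS_progression_from y_gt0 z_gt0 a_gt0 Wn); eexists.
Qed.

Lemma sieve_progression1 (j y z a b : nat) :
  sieve j y z (progression a b) 1 = (a + b)%N.
Proof.
by rewrite /sieve /= progression_from1 set_min_progression_from muln1.
Qed.

Lemma sieve_progressionS (j y z a b n : nat)
    (s := sieve j y z (progression a b)) :
  (0 < y)%N -> (0 < z)%N -> (0 < a)%N -> (0 < n)%N ->
  s n.+1 =
  (a * (if extra_deletion j y z n [seq s i | i <- index_iota 1 n.+1]
        then maxn y z else minn y z) + s n)%N.
Proof.
(* The term of index [n.+1] is the minimum of the state after [n] steps, hence the shift to a
   successor. *)
move=> y_gt0 z_gt0 a_gt0; case: n => // n _.
have [k Wn] := sieve_state_progression j b n y_gt0 z_gt0 a_gt0.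
rewrite {1}/s /sieve (sieve_stateS_progression_from y_gt0 z_gt0 a_gt0 Wn).
by rewrite /s /sieve Wn !set_min_progression_from mulnDr addnA.
Qed.

(** Exchanging the order of [y] and [z] negates the deletion condition and also changes which of
    them is the maximum; the two effects cancel. *)
Lemma extra_deletion_gap (j y z n : nat) (S : seq nat) : y != z ->
  (if extra_deletion j y z n S then maxn y z else minn y z) =
  if shift_in n.+1 j [seq v%:Z | v <- S] then y else z.
Proof.
by rewrite /extra_deletion; case: shift_in; case: ltngtP.
Qed.

Lemma sieve_progression_gap (j y z a b n : nat)
    (s := sieve j y z (progression a b)) :
  (0 < y)%N -> (0 < z)%N -> y != z -> (0 < a)%N -> (0 < n)%N ->
  (s n.+1)%:Z - (s n)%:Z =
  if shift_in n.+1 j [seq (s i)%:Z | i <- index_iota 1 n.+1]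
  then (a * y)%N%:Z else (a * z)%N%:Z.
Proof.
move=> y_gt0 z_gt0 y_neq_z a_gt0 n_gt0.
rewrite /s sieve_progressionS // extra_deletion_gap // -map_comp.
by rewrite PoszD addrK; case: ifP.
Qed.

Lemma sieve_progression_hiccup (j y z a b : nat) :
  (0 < y)%N -> (0 < z)%N -> y != z -> (0 < a)%N ->
  hiccup j (a + b) (a * y) (a * z)
    (fun n => (sieve j y z (progression a b) n)%:Z).
Proof.
(* [hiccup] indexes a gap by its upper end; with that end written [n.+1], the bound [2 <= n.+1] is
   [0 < n] by conversion. *)
move=> y_gt0 z_gt0 y_neq_z a_gt0; split=> [|n n_gt0|[//|n] n_gt0].
- by rewrite sieve_progression1.
- rewrite -subr_gt0 sieve_progression_gap //.
  by case: ifP => _; rewrite ltz_nat muln_gt0 a_gt0.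
- exact: sieve_progression_gap.
Qed.

Theorem theorem6p3 (j y z : nat) (y_gt0 : (0 < y)%N) (z_gt0 : (0 < z)%N)
    (y_neq_z : y != z) :
  (let s := sieve j y z positives in
   [/\ hiccup j 1 y z (fun n => (s n)%:Z),
       s 1%N = 1%N &
       forall n, (1 <= n)%N ->
         (s n.+1)%:Z - (s n)%:Z =
           if shift_in n.+1 j [seq (s i)%:Z | i <- index_iota 1 n.+1]
           then y%:Z else z%:Z])
  /\
  (forall a b : nat, (1 <= a)%N -> (b < a)%N ->
   let s := sieve j y z (progression a b) in
   [/\ hiccup j (a + b) (a * y) (a * z) (fun n => (s n)%:Z),
       s 1%N = (a + b)%N &
       forall n, (1 <= n)%N ->
         ((s n.+1)%:Z - (s n)%:Z = (a * y)%N%:Z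
          \/ (s n.+1)%:Z - (s n)%:Z = (a * z)%N%:Z)
         /\
         ((s n.+1)%:Z - (s n)%:Z = (a * maxn y z)%N%:Z
          <-> extra_deletion j y z n [seq s i | i <- index_iota 1 n.+1])]).
Proof.
split=> [s|a b a_gt0 _ s].
  rewrite /s positives_progression; split.
  - by have := sieve_progression_hiccup j 0 y_gt0 z_gt0 y_neq_z (ltn0Sn 0);
      rewrite addn0 !mul1n.
  - exact: sieve_progression1.
  - by move=> n n_gt0; rewrite sieve_progression_gap // !mul1n.
split=> [||n n_gt0].
- exact: sieve_progression_hiccup.
- exact: sieve_progression1.
split; first by rewrite /s sieve_progression_gap //; case: ifP; [left|right].
(* Here the gap is kept in terms of [extra_deletion]. Without the deletion it is [a * minn y z],
   which equals [a * maxn y z] only if [y = z]. *)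
rewrite /s sieve_progressionS // PoszD addrK.
case: extra_deletion => //; split=> // -[] /eqP.
by rewrite eqn_pmul2l //; move: y_neq_z; case: ltngtP => // ? _ /eqP ?; lia.
Qed.
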